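(* Assume the pairs $(b_t^1,b_t^2)\in\{0,1\}^2$ are generated i.i.d. across time $t=1,\dots,T$ from a joint distribution with marginals $b_t^1\sim\mathrm{Ber}(q_1)$ and $b_t^2\sim\mathrm{Ber}(q_2)$. If $q_1,q_2\ne 1/2$ and $q_1+q_2\ne 1$, then the ASB-DM algorithm $\mathcal A$ (see context) satisfies $$\mathbb E\{R^b_{\mathcal A}(T)\}=\mathbb E\{C^b_{\mathcal A}-C^b_{\mathsf{OPT}}\}=O(1),$$ i.e. the left-hand side is bounded above by a constant independent of $T$ (possibly depending on $q_1,q_2$).
   Context: At each time $t$ the algorithm chooses $x_t\in\{0,1\}$, after which $b_t^1,b_t^2$ are revealed. Costs: $$C^b_{\mathcal A}=\max\Big\{\sum_{t=1}^T\mathbf 1\{x_t\ne b_t^1\},\ \sum_{t=1}^T\mathbf 1\{x_t\ne b_t^2\}\Big\},\qquad C^b_{\mathsf{OPT}}=\min_{x\in\{0,1\}}\max\Big\{\sum_{t=1}^T\mathbf 1\{x\ne b_t^1\},\ \sum_{t=1}^T\mathbf 1\{x\ne b_t^2\}\Big\}.$$ Adaptive Stronger-Bias Double Majority (ASB-DM). At time $t$ let $\hat q_{k,t}=\frac1{t-1}\sum_{s=1}^{t-1}b_s^k$ for $k=1,2$ (with an arbitrary fixed convention at $t=1$). If $\hat q_{1,t}<1/2$ and $\hat q_{2,t}<1/2$, play $x_t=0$. Else if $\hat q_{1,t}\ge 1/2$ and $\hat q_{2,t}\ge 1/2$, play $x_t=1$. Otherwise let $\Sigma_t=\hat q_{1,t}+\hat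 q_{2,t}$ and play $x_t=0$ if $\Sigma_t<1$, and $x_t=1$ if $\Sigma_t\ge 1$. *)

(* Defs.v *)
From HB Require Import structures.
From mathcomp Require Import all_boot all_order all_algebra finmap.
From mathcomp Require Import all_classical all_reals all_analysis.

Set Implicit Arguments.
Unset Strict Implicit.
Unset Printing Implicit Defensive.

Import Order.TTheory GRing.Theory Num.Theory.
Import numFieldNormedType.Exports.

Local Open Scope classical_set_scope.
Local Open Scope ring_scope.

(* Bits are booleans (true is 1). Times start at 1, so a path is a function on
   nat whose value at 0 is never used. *)

Definition mistakes (n : nat) (x b : nat -> bool) : nat :=
  (\sum_(1 <= t < n.+1) (x t != b t))%N.

Definition cost (n : nat) (x : nat -> bool) (b : nat -> bool * bool) : nat :=
  maxn (mistakes n x (fun t => (b t).1)) (mistakes n x (fun t => (b t).2)).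

Definition cost_opt (n : nat) (b : nat -> bool * bool) : nat :=
  minn (cost n (fun=> false) b) (cost n (fun=> true) b).

(* [qinit] is the conventional value of the empirical mean at t = 1, where no
   observation is available. *)
Definition emp_mean (R : realType) (qinit : R) (b : nat -> bool) (t : nat) : R :=
  if t == 1%N then qinit else (t.-1)%:R^-1 * \sum_(1 <= s < t) (b s)%:R.

Definition asb_dm (R : realType) (qinit : R * R) (b : nat -> bool * bool)
    (t : nat) : bool :=
  let qh1 := emp_mean qinit.1 (fun s => (b s).1) t in
  let qh2 := emp_mean qinit.2 (fun s => (b s).2) t in
  if (qh1 < 2^-1) && (qh2 < 2^-1) then false
  else if (2^-1 <= qh1) && (2^-1 <= qh2) then true
  else if qh1 + qh2 < 1 then false
  else true.

Definition regret (R : realType) (n : nat) (x : nat -> bool)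
    (b : nat -> bool * bool) : R :=
  (cost n x b)%:R - (cost_opt n b)%:R.

Definition mutually_independent (R : realType) (I : choiceType)
    (d d' : measure_display) (Omega : measurableType d) (E : measurableType d')
    (P : probability Omega R) (D : set I) (X : I -> {RV P >-> E}) : Prop :=
  forall (J : {fset I}) (A : I -> set E),
    [set` J] `<=` D -> (forall i, measurable (A i)) ->
    P (\bigcap_(i in [set` J]) X i @^-1` A i) =
    (\prod_(i <- J) P (X i @^-1` A i))%E.

Definition iid (R : realType) (I : choiceType)
    (d d' : measure_display) (Omega : measurableType d) (E : measurableType d')
    (P : probability Omega R) (D : set I) (X : I -> {RV P >-> E})
    (mu : probability E R) : Prop :=
  mutually_independent D X /\
  forall i, D i -> forall A, measurable A -> distribution P (X i) A = mu A.

(* Main.v *)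
(* ASB-DM plays 1 exactly when the two empirical means add up to at least 1. If v
   is the better constant action in expectation (v = 1 iff q1 + q2 > 1), a round
   matters only if both bits equal v or both equal ~~v; let L_t be the lead of
   the latter over the former after t rounds. A play different from v at time
   t + 1 forces L_t >= 0, and the constant action v costs at most max(L_T, 0) more
   than the optimum. Each step of L has mean -|q1 + q2 - 1| < 0, so for some l > 1
   the expectation of l^L_t decays geometrically, uniformly over the joint laws
   with the given marginals (Chernoff). Summing over t bounds the regret. *)

Require Import Defs.
From HB Require Import structures.
From mathcomp Require Import all_boot all_order all_algebra finmap.
From mathcomp Require Import all_classical all_reals all_analysis.
From mathcomp Require Import zify ring lra.
From mathcomp Require Import measurable_realfun.

Set Implicit Arguments.
Unset Strict Implicit.
Unset Printing Implicit Defensive.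

Import Order.TTheory GRing.Theory Num.Theory.
Import numFieldNormedType.Exports.

Local Open Scope classical_set_scope.
Local Open Scope ring_scope.

(* No measurability is needed: the integral of a nonnegative function is defined as
   a supremum over the simple functions below it. *)
Lemma le_integral_ge0 (R : realType) (d : measure_display)
    (Omega : measurableType d) (P : {measure set Omega -> \bar R})
    (f g : Omega -> \bar R) :
  (forall x, 0 <= g x)%E -> (forall x, f x <= g x)%E ->
  (\int[P]_x f x <= \int[P]_x g x)%E.
Proof.
move=> g0 fg; rewrite integralE.
apply: (@le_trans _ _ (\int[P]_x f^\+ x)%E).
  by rewrite -[leRHS]sube0 leeB// integral_ge0.
rewrite !ge0_integralTE//; apply: ereal_sup_le => _ [h hf <-] /=.
exists h => // x; apply: le_trans (hf x) _.
by rewrite funeposE ge_max fg g0.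
Qed.

(** * Cylinder probabilities and expectations of products along an i.i.d. path *)

Lemma measurable_bool2 (A : set (bool * bool)) : measurable A.
Proof.
apply: countable_measurable => //; last exact: countableP.
move=> [x y]; rewrite (_ : [set _] = [set x] `*` [set y]).
  exact: measurableX.
by apply/seteqP; split=> [[? ?] [-> ->]|[? ?] [/= -> ->]].
Qed.

Section iid_product.
Context (R : realType) (d : measure_display) (Omega : measurableType d).
Context (P : probability Omega R) (mu : probability (bool * bool)%type R).
Context (T : nat) (b : nat -> {RV P >-> (bool * bool)%type}).
Hypothesis b_iid : iid [set t : nat | (1 <= t <= T)%N] b mu.

Lemma iid_cylinder n (g : 'I_n -> bool * bool) : (n <= T)%N ->
  P [set w | forall i : 'I_n, b i.+1 w = g i] =
  (\prod_(i < n) fine (mu [set g i]))%:E.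
Proof.
move=> nT; case: b_iid => indep dist.
(* Independence wants a set for every time, so [g] is shifted to the times 1 to [n] and padded with
   [setT] beyond them. The value at time 0 is harmless, as 0 is outside [J]. *)
pose A s : set (bool * bool) :=
  if insub s.-1 is Some i then [set g i] else setT.
have AE (i : 'I_n) : A i.+1 = [set g i] by rewrite /A /= valK.
pose J := [fset s in iota 1 n]%fset.
have JP s : (s \in J) = (1 <= s <= n)%N.
  by rewrite !inE mem_iota add1n ltnS.
have := indep J A _ (fun i => measurable_bool2 _).
rewrite (_ : \bigcap_(i in _) _ = [set w | forall i : 'I_n, b i.+1 w = g i]).
  move=> -> //.
    rewrite (perm_big (index_iota 1 n.+1)) /=; last first.
      by apply: uniq_perm; rewrite ?fset_uniq ?iota_uniq// => s;
        rewrite JP mem_index_iota.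
    rewrite big_add1 big_mkord -prodEFin.
    apply: eq_bigr => i _.
    rewrite fineK ?fin_num_measure//; last exact: measurable_bool2.
    rewrite AE; apply: dist; last exact: measurable_bool2.
    by rewrite /= (leq_trans (ltn_ord i) nT).
  by move=> s /=; rewrite JP => /andP[-> /leq_trans]; exact.
apply/seteqP; split => [w bw i|w bw s /=].
  have := bw i.+1; rewrite /= AE; apply; by rewrite JP /= ltn_ord.
rewrite JP; case: s => // s /= sn; have := bw (Ordinal sn).
by rewrite -[s.+1]/((Ordinal sn).+1) AE.
Qed.

Lemma measurable_cylinder n (g : 'I_n -> bool * bool) :
  measurable [set w | forall i : 'I_n, b i.+1 w = g i].
Proof.
rewrite (_ : [set _ | _] = \bigcap_(i in [set: 'I_n]) b i.+1 @^-1` [set g i]).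
  apply: fin_bigcap_measurable => // i _; rewrite -[_ @^-1` _]setTI.
  by apply: measurable_funP => //; exact: measurable_bool2.
by apply/seteqP; split => [w bw i _|w bw i]; exact: bw.
Qed.

(** There are finitely many prefixes of length [n], so the integrand is a finite combination of
    cylinder indicators. Distributivity then folds the sum over prefixes into an [n]-th power. *)
Lemma iid_integral_prod n (f : bool * bool -> R) : (n <= T)%N ->
  (forall c, 0 <= f c) ->
  (\int[P]_w (\prod_(i < n) f (b i.+1 w))%:E =
  ((\sum_c f c * fine (mu [set c])) ^+ n)%:E)%E.
Proof.
move=> nT f0.
pose C (g : {ffun 'I_n -> bool * bool}) :=
  [set w | forall i : 'I_n, b i.+1 w = g i].
have mC g : measurable (C g) by exact: measurable_cylinder.
transitivity (\int[P]_w \sum_(g : {ffun 'I_n -> bool * bool})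
    ((\prod_(i < n) f (g i))%:E * (\1_(C g) w)%:E))%E.
  apply: eq_integral => w _.
  pose g0 := [ffun i : 'I_n => b i.+1 w].
  rewrite (bigD1 g0)//= [X in (_ + X)%E]big1 ?adde0; last first.
    move=> g gg0; rewrite indicE memNset ?mule0// => Cg.
    by move/eqP: gg0; apply; apply/ffunP => i; rewrite ffunE Cg.
  rewrite indicE mem_set ?mule1; last by move=> i; rewrite ffunE.
  by congr (_%:E); apply: eq_bigr => i _; rewrite ffunE.
have pf0 (g : {ffun 'I_n -> bool * bool}) : 0 <= \prod_(i < n) f (g i).
  exact: prodr_ge0.
rewrite ge0_integral_sum//; first last.
- by move=> g w _; rewrite mule_ge0// lee_fin.
- move=> g; apply: measurable_funeM; apply/measurable_EFinP.
  exact: measurable_indic.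
transitivity (\sum_(g : {ffun 'I_n -> bool * bool})
    (\prod_(i < n) (f (g i) * fine (mu [set g i])))%:E)%E.
  apply: eq_bigr => g _; rewrite ge0_integralZl_EFin//; first last.
  - by apply/measurable_EFinP; exact: measurable_indic.
  rewrite integral_indic// setIT [X in (_ * X)%E](iid_cylinder g nT).
  by rewrite -EFinM -big_split.
rewrite sumEFin.
rewrite -(bigA_distr_bigA (fun (_ : 'I_n) c => f c * fine (mu [set c]))).
by rewrite prodr_const card_ord.
Qed.

End iid_product.

(** * Pathwise regret bound by counting unanimous rounds *)

Definition unanimous (n : nat) (v : bool) (b : nat -> bool * bool) : nat :=
  (\sum_(1 <= t < n.+1) (b t == (v, v)))%N.

Lemma mistakes_recr n x b :
  mistakes n.+1 x b = (mistakes n x b + (x n.+1 != b n.+1))%N.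
Proof. by rewrite /mistakes big_nat_recr. Qed.

Lemma unanimous_recr n v b :
  unanimous n.+1 v b = (unanimous n v b + (b n.+1 == (v, v)))%N.
Proof. by rewrite /unanimous big_nat_recr. Qed.

(** Under the action [v] a split round costs 1 in total, a round [(v, v)] costs 0 and a round
    [(~~ v, ~~ v)] costs 2. *)
Lemma mistakes_const_add n v b :
  (mistakes n (fun=> v) (fun t => (b t).1) +
   mistakes n (fun=> v) (fun t => (b t).2) + unanimous n v b =
   n + unanimous n (~~ v) b)%N.
Proof.
elim: n => [|n IH]; first by rewrite /mistakes /unanimous !big_geq.
rewrite !mistakes_recr !unanimous_recr.
by case: (b n.+1) => -[] []; case: v IH => /=; rewrite ?eqxx /=; lia.
Qed.

Lemma mistakes_negb n v b :
  (mistakes n (fun=> v) b + mistakes n (fun=> ~~ v) b = n)%N.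
Proof.
elim: n => [|n IH]; first by rewrite /mistakes !big_geq.
by rewrite !mistakes_recr; case: (b n.+1); case: v IH => /=; lia.
Qed.

Lemma mistakes_triangle n x y b :
  (mistakes n x b <= mistakes n x y + mistakes n y b)%N.
Proof.
rewrite /mistakes -big_split leq_sum// => t _.
by case: (x t) (y t) (b t) => -[] [].
Qed.

(** If constant [v] makes [a1] and [a2] mistakes, constant [~~ v] makes [n - a1] and [n - a2]. The
    two costs thus differ by [a1 + a2 - n], which is exactly the lead; truncated subtraction yields
    its positive part. *)
Lemma cost_le_opt n x v b :
  (cost n x b <=
   mistakes n x (fun=> v) + (unanimous n (~~ v) b - unanimous n v b) +
   cost_opt n b)%N.
Proof.
have := mistakes_const_add n v b.
have := mistakes_negb n v (fun t => (b t).1).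
have := mistakes_negb n v (fun t => (b t).2).
have := mistakes_triangle n x (fun=> v) (fun t => (b t).1).
have := mistakes_triangle n x (fun=> v) (fun t => (b t).2).
by rewrite /cost_opt /cost; case: v => /=; lia.
Qed.

Lemma asb_dmE (R : realType) (qinit : R * R) b t :
  asb_dm qinit b t = (1 <= emp_mean qinit.1 (fun s => (b s).1) t +
                           emp_mean qinit.2 (fun s => (b s).2) t).
Proof.
rewrite /asb_dm; set x := emp_mean _ _ _; set y := emp_mean _ _ _.
by case: ifPn => [|_]; [|case: ifPn => [|_]; [|case: ifPn]];
  move=> ?; apply/esym/idP; lra.
Qed.

Lemma emp_meanE (R : realType) (q : R) b n :
  emp_mean q b n.+2 = n.+1%:R^-1 * (mistakes n.+1 (fun=> false) b)%:R.
Proof.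
rewrite /emp_mean/= /mistakes natr_sum; congr (_ * _).
by apply: eq_bigr => i _; case: (b i).
Qed.

(** The index [n.+2] excludes round 1, where the play depends on [qinit]. The inequality is weak
    because a tie is played as 1, against [v = false]. *)
Lemma asb_dm_neq (R : realType) (qinit : R * R) b v n :
  asb_dm qinit b n.+2 != v ->
  (unanimous n.+1 v b <= unanimous n.+1 (~~ v) b)%N.
Proof.
rewrite asb_dmE !emp_meanE -mulrDr -natrD.
rewrite ler_pdivlMl ?ltr0n// mulr1 ler_nat => nv.
by have := mistakes_const_add n.+1 false b; case: v nv => /=; lia.
Qed.

(** This is [l] raised to the step of the lead, so products along a path are [l] to the power of the
    lead. *)
Definition tilt (R : realType) (l : R) (v : bool) (c : bool * bool) : R :=
  if c == (~~ v, ~~ v) then l else if c == (v, v) then l^-1 else 1.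

Lemma tilt_ge0 (R : realType) (l : R) v c : 0 <= l -> 0 <= tilt l v c.
Proof. by move=> l0; rewrite /tilt; do 2 case: ifP => _ //;
  rewrite invr_ge0. Qed.

Lemma prod_tilt (R : realType) (l : R) v b n :
  \prod_(i < n) tilt l v (b i.+1) =
  l ^+ unanimous n (~~ v) b / l ^+ unanimous n v b.
Proof.
elim: n => [|n IH].
  by rewrite big_ord0 /unanimous !big_geq// !expr0 divr1.
rewrite big_ord_recr /= IH !unanimous_recr !exprD invfM /tilt.
(* Writing the exclusivity of the two events into the exponent lets the case split follow the tests
   in [tilt]. *)
have {2}-> : (b n.+1 == (v, v)) = (b n.+1 == (v, v)) && (b n.+1 != (~~ v, ~~ v)).
  by case: (b n.+1) (v) => -[] [] [].
by do 2 case: eqP => _ //=; rewrite ?expr0 ?expr1 ?mulr1 ?invr1 //= ?mulr1; ring.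
Qed.

Lemma prod_tilt_ge1 (R : realType) (l : R) v b n : 1 <= l ->
  (unanimous n v b <= unanimous n (~~ v) b)%N ->
  1 <= \prod_(i < n) tilt l v (b i.+1).
Proof.
move=> l1 vb; rewrite prod_tilt ler_pdivlMr ?exprn_gt0 ?(lt_le_trans ltr01)//.
by rewrite mul1r ler_weXn2l.
Qed.

Lemma bernoulli_inequality (R : realType) (u : R) n : 0 <= u ->
  1 + n%:R * u <= (1 + u) ^+ n.
Proof.
move=> u0; elim: n => [|n IH]; first by rewrite mul0r addr0.
rewrite exprS; apply: le_trans (ler_wpM2l _ IH); last lra.
have : 0 <= n%:R * u * u by rewrite !mulr_ge0.
rewrite -natr1; nra.
Qed.

(** A lead [k >= 0] satisfies [k * u <= (1 + u) ^ k] by Bernoulli; a negative lead truncates to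
    0. *)
Lemma lead_le_prod_tilt (R : realType) (u : R) v b n : 0 < u ->
  (unanimous n (~~ v) b - unanimous n v b)%:R <=
  u^-1 * \prod_(i < n) tilt (1 + u) v (b i.+1).
Proof.
move=> u0; have l0 : 0 < 1 + u by lra.
rewrite ler_pdivlMl// mulrC.
case: (leqP (unanimous n v b) (unanimous n (~~ v) b)) => [vb|/ltnW vb].
  rewrite prod_tilt -expfB_cond ?gt_eqF//.
  by apply: le_trans (bernoulli_inequality _ (ltW u0)); rewrite lerDr.
rewrite (eqP vb) mul0r; apply: prodr_ge0 => i _; apply: tilt_ge0; exact: ltW.
Qed.

Lemma regret_le (R : realType) (u : R) v (qinit : R * R) b n : 0 < u ->
  regret R n (asb_dm qinit b) b <=
  \sum_(t < n) \prod_(i < t) tilt (1 + u) v (b i.+1) +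
  u^-1 * \prod_(i < n) tilt (1 + u) v (b i.+1).
Proof.
move=> u0.
apply: (@le_trans _ _ ((mistakes n (asb_dm qinit b) (fun=> v))%:R +
                       (unanimous n (~~ v) b - unanimous n v b)%:R)).
  by rewrite /regret lerBlDr -!natrD ler_nat cost_le_opt.
apply: lerD (lead_le_prod_tilt _ _ _ u0).
rewrite /mistakes big_add1 big_mkord natr_sum; apply: ler_sum => -[t tn] _ /=.
case: (boolP (_ != _)) => [xv|_]; last first.
  by apply: prodr_ge0 => i _; apply: tilt_ge0; lra.
(* Round 1 is paid for by the empty product, whatever [qinit] is. *)
case: t tn xv => [|t] _ xv; first by rewrite big_ord0.
by apply: prod_tilt_ge1 (asb_dm_neq xv); lra.
Qed.

(** * Exponential moment of one step of the lead *)

Lemma sum_bool2 (R : nmodType) (F : bool * bool -> R) :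
  \sum_c F c = F (true, true) + F (true, false) +
               (F (false, true) + F (false, false)).
Proof.
rewrite (eq_bigr (fun c => F (c.1, c.2))); last by case.
by rewrite -(pair_bigA _ (fun x y => F (x, y))) !big_bool.
Qed.

Section marginals.
Context (R : realType) (mu : probability (bool * bool)%type R).
Local Notation m x y := (fine (mu [set (x, y)])).

Lemma fine_measure_pair c1 c2 : c1 != c2 ->
  mu [set c1; c2] = (fine (mu [set c1]) + fine (mu [set c2]))%:E.
Proof.
move=> /eqP cc; rewrite measureU; try exact: measurable_bool2.
  by rewrite EFinD !fineK// fin_num_measure//; exact: measurable_bool2.
by apply/seteqP; split => // c [/= -> /cc].
Qed.

Lemma pushforward_fst x : pushforward mu fst [set x] = (m x true + m x false)%:E.
Proof.
rewrite -fine_measure_pair; last by rewrite xpair_eqE andbF.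
congr (mu _); apply/seteqP; split => [[y []] /= ->|[y z] [] [-> ->]//].
  by left.
by right.
Qed.

Lemma pushforward_snd x : pushforward mu snd [set x] = (m true x + m false x)%:E.
Proof.
rewrite -fine_measure_pair; last by rewrite xpair_eqE.
congr (mu _); apply/seteqP; split => [[[] y] /= ->|[y z] [] [-> ->]//].
  by left.
by right.
Qed.

Lemma tilt_mean_le (v : bool) (dl : R) :
  0 < dl -> \sum_c fine (mu [set c]) = 1 -> m v v - m (~~ v) (~~ v) = dl ->
  \sum_c tilt (1 + dl / 2) v c * fine (mu [set c]) <= 1 - dl ^+ 2 / 4.
Proof.
move=> d0; have ge0 x y : 0 <= m x y by exact: fine_ge0.
rewrite !sum_bool2 => m1.
have := ge0 true true; have := ge0 true false.
have := ge0 false true; have := ge0 false false => m0 m2 m3 m4 mdl.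
(* With [u = dl / 2] and [p = x / (1 + u)], the left side is [x + y - u * dl + u ^ 2 * p]. Since
   [p <= 1], the change is at most [u ^ 2 - u * dl], which this [u] minimizes to [- dl ^ 2 / 4]. *)
have key x y : 0 <= x <= 1 -> x - y = dl ->
    (1 + dl / 2)^-1 * x + (1 + dl / 2) * y <= x + y - dl ^+ 2 / 4.
  move=> x01 xy; set p := _^-1 * x.
  have px : (1 + dl / 2) * p = x by rewrite /p mulrA divff ?mul1r//; lra.
  have p1 : p <= 1 by rewrite ler_pdivrMl; lra.
  have : 0 <= dl * (1 - p) by rewrite mulr_ge0; lra.
  rewrite -px in xy *; have -> : y = (1 + dl / 2) * p - dl by lra.
  by nra.
have : 0 <= m v v <= 1 by case: (v); lra.
move=> /key/(_ mdl) {key mdl}.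
by rewrite /tilt; case: v => /=; lra.
Qed.

End marginals.

(** * Expected regret bounded by a geometric series *)

Lemma bernoulli_prob1 (R : realType) (q : R) x : 0 <= q <= 1 ->
  bernoulli_prob q [set x] = (if x then q else 1 - q)%:E.
Proof.
move=> hq; rewrite bernoulli_probE// !diracE.
have E y : (y \in [set x]) = (y == x) by apply/idP/eqP; rewrite inE.
by rewrite !E; case: (x); rewrite /= ?mule1 ?mule0 ?adde0 ?add0e.
Qed.

Theorem theorem11 (R : realType) (q1 q2 : R)
    (hq1 : 0 <= q1 <= 1) (hq2 : 0 <= q2 <= 1)
    (hq1_half : q1 <> 2^-1) (hq2_half : q2 <> 2^-1) (hq12 : q1 + q2 <> 1) :
  exists K : R,
    forall (qinit : R * R)
      (d : measure_display) (Omega : measurableType d)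
      (P : probability Omega R)
      (mu : probability (bool * bool)%type R)
      (T : nat) (b : nat -> {RV P >-> (bool * bool)%type}),
      (forall A : set bool, pushforward mu fst A = bernoulli_prob q1 A) ->
      (forall A : set bool, pushforward mu snd A = bernoulli_prob q2 A) ->
      iid [set t : nat | (1 <= t <= T)%N] b mu ->
      ('E_P[fun w : Omega =>
              regret R T (asb_dm qinit (fun t => b t w)) (fun t => b t w)]
       <= K%:E)%E.
Proof.
pose dl : R := `|q1 + q2 - 1|.
have dl0 : 0 < dl by rewrite normr_gt0 subr_eq0; exact/eqP.
have dl1 : dl <= 1 by rewrite ler_norml; lra.
pose r := 1 - dl ^+ 2 / 4; pose u := dl / 2.
have u0 : 0 < u by rewrite divr_gt0.
have r01 : 0 <= r < 1 by rewrite /r; nra.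
(* The first term sums the series of the [r ^ t], bounding the expected number of plays other than
   [v]; the second bounds the expected positive part of the final lead. *)
exists ((1 - r)^-1 + u^-1) => qinit d Omega P mu T b fst_mu snd_mu b_iid.
pose v : bool := 1 < q1 + q2.
pose f := tilt (1 + u) v.
have f0 c : 0 <= f c by apply: tilt_ge0; lra.
pose rho := \sum_c f c * fine (mu [set c]).
have rho0 : 0 <= rho by apply: sumr_ge0 => c _; rewrite mulr_ge0// fine_ge0.
have rho_r : rho <= r.
  (* The marginals alone give total mass 1 and show that the masses of [(true, true)] and
     [(false, false)] differ by [q1 + q2 - 1]; the choice of [v] turns this into [dl]. *)
  have := pushforward_fst mu true; have := pushforward_fst mu false.
  have := pushforward_snd mu true.
  rewrite !fst_mu snd_mu !bernoulli_prob1// => -[mT] [m_F] [m_T].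
  apply: tilt_mean_le => //.
    by rewrite sum_bool2; lra.
  rewrite /dl /v; case: ltP => /= h; [rewrite gtr0_norm|rewrite ler0_norm]; lra.
have prod_int n : (n <= T)%N ->
    (\int[P]_w (\prod_(i < n) f (b i.+1 w))%:E = (rho ^+ n)%:E)%E.
  by move=> nT; exact: (iid_integral_prod b_iid).
have mf n : measurable_fun setT (fun w => (\prod_(i < n) f (b i.+1 w))%:E).
  apply/measurable_EFinP; apply: measurable_prod => i _.
  apply: (measurableT_comp (f := f)) => // _ Y _.
  exact: measurable_bool2.
have pf0 n w : (0 <= (\prod_(i < n) f (b i.+1 w))%:E)%E.
  by rewrite lee_fin prodr_ge0.
rewrite unlock.
apply: (@le_trans _ _ (\int[P]_w (\sum_(t < T) (\prod_(i < t) f (b i.+1 w))%:E +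
    (u^-1)%:E * (\prod_(i < T) f (b i.+1 w))%:E))%E).
  apply: le_integral_ge0 => w.
    by rewrite adde_ge0 ?sume_ge0// mule_ge0// lee_fin invr_ge0 ltW.
  by rewrite sumEFin -EFinM -EFinD lee_fin; exact: regret_le.
rewrite ge0_integralD//; first last.
- exact: measurable_funeM.
- by move=> w _; rewrite mule_ge0// lee_fin invr_ge0 ltW.
- exact: emeasurable_sum.
- by move=> w _; rewrite sume_ge0.
rewrite ge0_integral_sum// ge0_integralZl_EFin//; last by rewrite invr_ge0 ltW.
rewrite (eq_bigr (fun t : 'I_T => (rho ^+ t)%:E)); last first.
  by move=> t _; apply: prod_int; exact: ltnW.
rewrite (prod_int T (leqnn T)) sumEFin -EFinM -EFinD lee_fin.
have pr n : rho ^+ n <= r ^+ n by rewrite lerXn2r// nnegrE; lra.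
apply: lerD.
  apply: (@le_trans _ _ (\sum_(t < T) r ^+ t)); first exact: ler_sum.
  have r1 : 0 < 1 - r by lra.
  rewrite -[leRHS]mul1r ler_pdivlMr//.
  have := subrX1 r T; have : 0 <= r ^+ T by rewrite exprn_ge0; lra.
  by move: (\sum_(_ < _) _) (r ^+ T) => S x; nra.
have uV0 : 0 <= u^-1 by rewrite invr_ge0 ltW.
rewrite -[leRHS]mulr1 ler_wpM2l//; apply: le_trans (pr T) _.
by rewrite exprn_ile1; lra.
Qed.
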